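(* Let $(X,d)$ be a Polish metric space, let $1\le p<\infty$, and let $\{m_x\}_{x\in X}$ be a random walk on $X$ with $m_x\in\mathcal{P}_p(X)$ for every $x\in X$. Define $\tilde m:\mathcal{P}_p(X)\to\mathcal{P}(\mathcal{P}_p(X))$ by $$\int_{\mathcal{P}_p(X)} f(\sigma)\,\tilde m_\mu(d\sigma)=\int_X f(m_x)\,\mu(dx)\qquad\text{for all } f\in\mathcal{C}_b(\mathcal{P}_p(X)),$$ i.e. $\tilde m_\mu$ is the push-forward of $\mu$ under $x\mapsto m_x$. Then $\{\tilde m_\mu\}_{\mu\in\mathcal{P}_p(X)}$ is a random walk on the metric space $(\mathcal{P}_p(X),W_p)$ and $$\inf_{x,y\in X,\ x\neq y}\kappa^m_p(x,y)=\inf_{\mu,\nu\in\mathcal{P}_p(X),\ \mu\ne\nu}\kappa^{\tilde m}_p(\mu,\nu),$$ where, if one side is $-\infty$, so is the other.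
   Context: A random walk on a metric space $Y$ is a family $\{m_y\}_{y\in Y}$ of Borel probability measures on $Y$. $\mathcal{P}(Y)$ denotes the Borel probability measures on $Y$ with the weak topology. For $1\le p<\infty$, $\mathcal{P}_p(Y)=\{\mu\in\mathcal{P}(Y): \int d(o,y)^p\,\mu(dy)<\infty \text{ for some } o\in Y\}$, and the $L^p$-Wasserstein distance is $W_p(\mu,\nu)=\inf_{\pi}\big(\int d(x,y)^p\,\pi(dx,dy)\big)^{1/p}$, the infimum over couplings $\pi$ of $\mu$ and $\nu$ (probability measures on $Y\times Y$ with marginals $\mu,\nu$). $(\mathcal{P}_p(Y),W_p)$ is a Polish metric space when $Y$ is. For a random walk $\{m_y\}$ on $Y$ and distinct $x,y\in Y$, the $p$-coarse Ricci curvature is $\kappa^m_p(x,y)=1-W_p(m_x,m_y)/d(x,y)$. $\mathcal{C}_b$ denotes bounded continuous functions.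
   Formalization: The map x ↦ m_x from X to (P_p(X), W_p) is additionally assumed Borel measurable; without this the push-forward m̃_μ (the integral of f(m_x) against μ) need not be defined. *)

(* Defs.v *)
From HB Require Import structures.
From mathcomp Require Import all_boot all_order all_algebra.
From mathcomp Require Import all_classical all_reals all_analysis.
Set Implicit Arguments. Unset Strict Implicit. Unset Printing Implicit Defensive.
Import Order.TTheory GRing.Theory Num.Theory.
Import numFieldNormedType.Exports.
Local Open Scope classical_set_scope.
Local Open Scope ring_scope.

Section Defs.
Context {R : realType}.

Definition is_metric {T : Type} (dist : T -> T -> R) : Prop :=
  [/\ forall x y, 0 <= dist x y,
      forall x y, dist x y = 0 <-> x = y,
      forall x y, dist x y = dist y x &
      forall x y z, dist x z <= dist x y + dist y z].

Definition dball {T : Type} (dist : T -> T -> R) (x : T) (e : R) : set T :=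
  [set y | dist x y < e].

Definition metric_open {T : Type} (dist : T -> T -> R) : set (set T) :=
  [set B | forall x, B x -> exists2 e, 0 < e & dball dist x e `<=` B].

Definition metric_complete {T : Type} (dist : T -> T -> R) : Prop :=
  forall u : nat -> T,
    (forall e, 0 < e -> exists N, forall n k, (N <= n)%N -> (N <= k)%N ->
        dist (u n) (u k) < e) ->
    exists l, (fun n => dist (u n) l) @ \oo --> 0.

Definition metric_separable {T : Type} (dist : T -> T -> R) : Prop :=
  exists D : set T, countable D /\
    forall x e, 0 < e -> exists2 y, D y & dist x y < e.

Definition polish_metric {T : Type} (dist : T -> T -> R) : Prop :=
  [/\ is_metric dist, metric_complete dist & metric_separable dist].

Definition borel_for {d} {T : measurableType d} (dist : T -> T -> R) : Prop :=
  @measurable _ T = <<s metric_open dist >>.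

Local Open Scope ereal_scope.

Definition couplings {d} {T : measurableType d} (mu nu : set T -> \bar R)
  : set (probability (T * T)%type R) :=
  [set pi | forall A, measurable A ->
      pi (fst @^-1` A) = mu A /\ pi (snd @^-1` A) = nu A].

Definition Wp {d} {T : measurableType d} (c : T -> T -> R) (p : R)
  (mu nu : set T -> \bar R) : \bar R :=
  ereal_inf [set (\int[pi]_z ((c z.1 z.2) `^ p)%:E) `^ (p^-1)%R
            | pi in couplings mu nu].

Definition Pp {d} {T : measurableType d} (c : T -> T -> R) (p : R)
  : set (probability T R) :=
  [set mu | exists o : T, \int[mu]_x ((c o x) `^ p)%:E < +oo].

Local Close Scope ereal_scope.

Definition kappa {T : Type} (dist : T -> T -> R) (W : T -> T -> \bar R)
  (x y : T) : \bar R :=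
  (1%:E - W x y * ((dist x y)^-1)%:E)%E.

Definition inf_kappa {T : Type} (dist : T -> T -> R) (W : T -> T -> \bar R)
  : \bar R :=
  ereal_inf [set k | exists x y, x <> y /\ k = kappa dist W x y].

End Defs.

(* The carrier is {mu | mu \in P_p(X)}; the parameter w is a distinguished
   element (measurable types in MathComp-Analysis must be pointed). *)
Section PpType.
Context {R : realType} {d} {X : measurableType d} (dist : X -> X -> R) (p : R).

Definition PpT (w : {mu : probability X R | Pp dist p mu}) :=
  {mu : probability X R | Pp dist p mu}.

Variable w : {mu : probability X R | Pp dist p mu}.
HB.instance Definition _ := gen_eqMixin (PpT w).
HB.instance Definition _ := gen_choiceMixin (PpT w).
HB.instance Definition _ := isPointed.Build (PpT w) w.

(* the distance W_p on P_p(X) (finite there) *)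
Definition dW (a b : PpT w) : R := fine (Wp dist p (proj1_sig a) (proj1_sig b)).

Definition WpSpace := g_sigma_algebraType (@metric_open R (PpT w) dW).

End PpType.

Arguments PpT {R d X} dist p w.
Arguments dW {R d X} dist p {w} a b.
Arguments WpSpace {R d X} dist p w.

Definition dWS {R : realType} {d} {X : measurableType d} (dist : X -> X -> R)
  (p : R) (w : {mu : probability X R | Pp dist p mu})
  : WpSpace dist p w -> WpSpace dist p w -> R := @dW R d X dist p w.
Arguments dWS {R d X} dist p w _ _.

(* Main.v *)
(* Diracs embed X isometrically into P_p(X) and the push-forward of a Dirac at x
   is the Dirac at m_x, so the infimum over measures is at most the one over
   points.  Conversely, a lower curvature bound k says that x |-> m_x is
   (1 - k)-Lipschitz; pushing a coupling of mu and nu forward by (m, m) gives a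
   coupling of the images whose cost is scaled by at most (1 - k).

   The integral of a nonmeasurable nonnegative function is a lower integral here,
   and both steps use only inequalities valid for it, so the measurability of W_p
   on P_p(X) x P_p(X) plays no role.

   The value of kappa at two elements of P_p(X) that are distinct but agree on
   measurable sets (so W_p = 0) is 1, since 0^-1 = 0; it does not affect the
   infimum, as the curvature is at most 1 everywhere. *)
Require Import Defs.
From HB Require Import structures.
From mathcomp Require Import all_boot all_order all_algebra.
From mathcomp Require Import all_classical all_reals all_analysis.
From mathcomp Require Import measurable_realfun.
Set Implicit Arguments. Unset Strict Implicit.
Unset Printing Implicit Defensive.
Import Order.TTheory GRing.Theory Num.Theory.
Local Open Scope classical_set_scope.
Local Open Scope ring_scope.

(** * Inequalities for lower integrals of nonnegative functions *)

Section lower_integral.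
Local Open Scope ereal_scope.
Context d (T : measurableType d) (R : realType) (mu : {measure set T -> \bar R}).
Import HBNNSimple.

(** The integral is a supremum over simple functions below the integrand, and each one below [f] is
    also below [g]. *)
Lemma ge0_le_integralT (f g : T -> \bar R) :
  (forall x, 0 <= f x) -> (forall x, f x <= g x) ->
  \int[mu]_x f x <= \int[mu]_x g x.
Proof.
move=> f0 fg; have g0 x : 0 <= g x := le_trans (f0 x) (fg x).
rewrite !ge0_integralTE//; apply: ge_ereal_sup => _ [h /= hf <-].
by apply: ereal_sup_ubound; exists h => //= x; exact: le_trans (hf x) (fg x).
Qed.

(** A simple [h] below [f] gives the simple function [h \o phi] below [f \o phi]. Only one
    inequality is claimed, since a simple function below [f \o phi] need not factor through
    [phi]. *)
Lemma ge0_le_integral_pushforward d' (U : measurableType d') (phi : T -> U)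
    (mphi : measurable_fun setT phi) (f : U -> \bar R) :
  (forall y, 0 <= f y) ->
  \int[pushforward mu phi]_y f y <= \int[mu]_x f (phi x).
Proof.
move=> f0; rewrite [leLHS]ge0_integralTE//.
apply: ge_ereal_sup => _ [h /= hf <-].
rewrite -integralT_nnsfun ge0_integral_pushforward//=; last first.
- by move=> y _; rewrite lee_fin.
- exact/measurable_EFinP/measurable_funP.
- rewrite preimage_setT; apply: ge0_le_integralT => x /=; last exact: hf.
  by rewrite lee_fin.
Qed.

Lemma ge0_markovT (A : set T) (a : R) (f : T -> \bar R) : measurable A ->
  (0 <= a)%R -> (forall x, 0 <= f x) -> (forall x, A x -> a%:E <= f x) ->
  a%:E * mu A <= \int[mu]_x f x.
Proof.
move=> mA a0 f0 af; rewrite -[A in mu A]setIT -integral_indic//.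
rewrite -ge0_integralZl_EFin//; last exact/measurable_EFinP/measurable_indic.
apply: ge0_le_integralT => x; first by rewrite mule_ge0 ?lee_fin.
rewrite indicE; case: (boolP (x \in A)) => [|_]; last by rewrite mule0.
by rewrite inE mule1; exact: af.
Qed.

End lower_integral.

(** * Auxiliary facts on probabilities, real powers and countable unions *)

Lemma probability_setI1 d (T : measurableType d) (R : realType)
    (P : probability T R) (A B : set T) : measurable A -> measurable B ->
  P A = 1%E -> P B = 1%E -> P (A `&` B) = 1%E.
Proof.
move=> mA mB PA PB; have mAB := measurableI _ _ mA mB.
have PC C : measurable C -> P C = 1%E -> P (~` C) = 0%E.
  by move=> mC PC1; rewrite probability_setC// PC1 subee.
have : P (~` (A `&` B)) = 0%E.
  apply/eqP; rewrite eq_le measure_ge0 andbT setCI.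
  apply: le_trans (measureU2 _ (measurableC mA) (measurableC mB)) _.
  by rewrite /= !PC// adde0.
rewrite probability_setC// => h.
have /fineK PABE : P (A `&` B) \is a fin_num by exact: fin_num_measure.
move: h; rewrite -PABE -EFinB => -[/eqP]; rewrite subr_eq0 => /eqP <-.
by [].
Qed.

Lemma powRD_le (R : realType) (a b p : R) : 0 <= a -> 0 <= b -> 0 <= p ->
  (a + b) `^ p <= 2 `^ p * (a `^ p + b `^ p).
Proof.
move=> a0 b0 p0; wlog ab : a b a0 b0 / a <= b.
  move=> H; case: (leP a b) => [|/ltW] ab; first exact: H.
  by rewrite addrC (addrC (a `^ p)); exact: H.
apply: (@le_trans _ _ ((2 * b) `^ p)).
  apply: ge0_ler_powR => //; rewrite ?nnegrE ?addr_ge0// ?mulr_ge0//.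
  by rewrite mulr_natl mulr2n lerD2r.
by rewrite powRM// ler_wpM2l ?powR_ge0// lerDr powR_ge0.
Qed.

Lemma poweR_powRV (R : realType) (x p : R) : 0 <= x -> p != 0 ->
  ((x `^ p)%:E `^ p^-1 = x%:E)%E.
Proof. by move=> x0 p0; rewrite poweR_EFin -powRrM mulfV// powRr1. Qed.

(** Apart from the set function, a probability consists of proofs, which are identified by proof
    irrelevance. *)
Lemma eq_probability d (T : measurableType d) (R : realType)
  (P Q : probability T R) : (P = Q :> (set T -> \bar R)) -> P = Q.
Proof.
case: P Q => [P [[a1 a2] [a3] [a4] [a5] [a6] [a7] [a8]]].
move=> [Q [[b1 b2] [b3] [b4] [b5] [b6] [b7] [b8]]] /= PQ; subst Q.
rewrite (Prop_irrelevance a1 b1) (Prop_irrelevance a2 b2).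
rewrite (Prop_irrelevance a3 b3) (Prop_irrelevance a4 b4).
rewrite (Prop_irrelevance a5 b5) (Prop_irrelevance a6 b6).
by rewrite (Prop_irrelevance a7 b7) (Prop_irrelevance a8 b8).
Qed.

Lemma probability_singleton_eq d (T : measurableType d) (R : realType)
  (P Q : probability T R) : (forall x : T, x = point) -> P = Q.
Proof.
move=> T1; apply: eq_probability; apply/funext => A.
have [Ap|nAp] := pselect (A point).
  have -> : A = setT by apply/seteqP; split=> // x _; rewrite (T1 x).
  by rewrite !probability_setT.
have -> : A = set0 by apply/seteqP; split=> // x; rewrite (T1 x).
by rewrite !measure0.
Qed.

(** An injection of [D] into the naturals reindexes the union; each of its fibres is empty or a
    single index. *)
Lemma countable_bigcup_measurable d (T : measurableType d) (U : Type)
    (D : set U) (F : U -> set T) : countable D ->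
  (forall i, D i -> measurable (F i)) -> measurable (\bigcup_(i in D) F i).
Proof.
move=> /pcard_injP[f injf] mF.
have -> : \bigcup_(i in D) F i =
    \bigcup_n \bigcup_(i in [set i | D i /\ f i = n]) F i.
  apply/seteqP; split=> [x [i Di Fx]|x [n _ [i [Di _] Fx]]]; last by exists i.
  by exists (f i) => //; exists i.
apply: bigcupT_measurable => n.
have [[i [Di fi]]|noi] := pselect (exists i, D i /\ f i = n); last first.
  rewrite bigcup0// => i Di; by exfalso; apply: noi; exists i.
suff -> : [set i | D i /\ f i = n] = [set i] by rewrite bigcup_set1; exact: mF.
apply/seteqP; split=> [j [Dj fj]|_ ->//].
by apply: injf; rewrite ?inE// fi fj.
Qed.

(** * Transport cost for a general cost function, and integrals under couplings *)

Section transport_cost.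
Local Open Scope ereal_scope.
Context d (T : measurableType d) (R : realType) (c : T -> T -> R) (p : R).

Lemma Wp_ge0 mu nu : 0 <= Wp c p mu nu.
Proof. by apply/ereal_infP => _ [pi _ <-]; exact: poweR_ge0. Qed.

Lemma eq_Wp mu nu mu' nu' : (forall A, measurable A -> mu A = mu' A) ->
  (forall A, measurable A -> nu A = nu' A) -> Wp c p mu nu = Wp c p mu' nu'.
Proof.
move=> mm nn; congr (ereal_inf _); congr image; apply/seteqP.
by split=> pi cpi A mA; have := cpi _ mA; rewrite mm// nn.
Qed.

(** The joint law of [(f, g)] under [pi] is a coupling of [mu] and [nu]. All upper bounds on [Wp]
    below come from this by a choice of [pi], [f] and [g]. *)
Lemma Wp_le_map d' (Z : measurableType d') (pi : probability Z R)
    (f g : Z -> T) (mu nu : set T -> \bar R) :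
  measurable_fun setT f -> measurable_fun setT g ->
  (forall A, measurable A -> mu A = pi (f @^-1` A)) ->
  (forall A, measurable A -> nu A = pi (g @^-1` A)) -> (0 <= p)%R ->
  Wp c p mu nu <= (\int[pi]_z (c (f z) (g z) `^ p)%:E) `^ p^-1.
Proof.
move=> mf mg muf nug p0.
have mfg : measurable_fun setT (fun z => (f z, g z)).
  exact: measurable_fun_pair.
pose mfg_mixin := isMeasurableFun.Build _ _ _ _ _ mfg.
pose h : {mfun Z >-> (T * T)%type} := HB.pack (fun z => (f z, g z)) mfg_mixin.
apply: ge_ereal_inf; exists ((\int[distribution pi h]_z
    (c z.1 z.2 `^ p)%:E) `^ p^-1).
  by exists (distribution pi h) => // A mA; rewrite muf// nug.
apply: gt0_ler_poweR; rewrite ?invr_ge0// ?in_itv/= ?leey ?andbT.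
- by apply: integral_ge0 => z _; rewrite lee_fin powR_ge0.
- by apply: integral_ge0 => z _; rewrite lee_fin powR_ge0.
- apply: (ge0_le_integral_pushforward pi mfg) => z.
  by rewrite lee_fin powR_ge0.
Qed.

Lemma Wp_sym mu nu : (0 <= p)%R -> (forall x y, c x y = c y x) ->
  Wp c p nu mu <= Wp c p mu nu.
Proof.
move=> p0 csym; apply/ereal_infP => _ [pi cpi <-].
under eq_integral do rewrite csym.
by apply: Wp_le_map => // A mA; rewrite (cpi _ mA).1 || rewrite (cpi _ mA).2.
Qed.

Lemma Wp_id (mu : probability T R) : (0 < p)%R -> (forall x, c x x = 0%R) ->
  Wp c p mu mu = 0.
Proof.
move=> p0 c0; apply/eqP; rewrite eq_le Wp_ge0 andbT.
apply: le_trans; first by apply: (@Wp_le_map _ _ mu id id) => //; exact: ltW.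
under eq_integral do rewrite c0 powR0 ?gt_eqF//.
by rewrite integral0 poweR0r// gt_eqF// invr_gt0.
Qed.

Lemma Wp_dirac_le (x y : T) : (0 < p)%R -> (0 <= c x y)%R ->
  Wp c p \d_x \d_y <= (c x y)%:E.
Proof.
move=> p0 c0.
apply: le_trans.
  (* Constant maps send any probability to Diracs; [\d_x] is just one at hand. *)
  by apply: (@Wp_le_map _ _ \d_x (cst x) (cst y)) => //; exact: ltW.
rewrite [integral _ _ _](integral_cst _ measurableT (c x y `^ p)%:E) /=.
by rewrite indicT mulr1 -powRrM mulfV ?gt_eqF// powRr1.
Qed.

End transport_cost.

Lemma coupling_integral d d' (Z : measurableType d') (T : measurableType d)
    (R : realType) (pi : probability Z R) (mu : probability T R) (f : Z -> T)
    (g : T -> \bar R) : measurable_fun setT f ->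
  (forall A, measurable A -> pi (f @^-1` A) = mu A) ->
  measurable_fun setT g -> (forall x, 0 <= g x)%E ->
  (\int[pi]_z g (f z) = \int[mu]_x g x)%E.
Proof.
move=> mf pf mg g0.
transitivity (\int[pushforward pi f]_x g x)%E.
  by rewrite ge0_integral_pushforward.
by apply: eq_measure_integral => A mA _; exact: pf.
Qed.

(** Integrates the pointwise bound [powRD_le]; finiteness is all that is sought, so its crude
    constant suffices in place of Minkowski's inequality. *)
Lemma integral_powRD_lty d (Z : measurableType d) (R : realType)
    (P : probability Z R) (p : R) (a b c : Z -> R) : 0 <= p ->
  measurable_fun setT a -> measurable_fun setT b ->
  (forall z, 0 <= a z) -> (forall z, 0 <= b z) -> (forall z, 0 <= c z) ->
  (forall z, c z <= a z + b z) ->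
  (\int[P]_z (a z `^ p)%:E < +oo -> \int[P]_z (b z `^ p)%:E < +oo ->
  \int[P]_z (c z `^ p)%:E < +oo)%E.
Proof.
move=> p0 ma mb a0 b0 c0 cab ia ib.
have mp (h : Z -> R) : measurable_fun setT h ->
    measurable_fun setT (fun z => (h z `^ p)%:E).
  move=> mh; apply/measurable_EFinP.
  exact: (measurableT_comp (measurable_powR p)).
apply: (@le_lt_trans _ _
    (\int[P]_z ((2 `^ p)%:E * ((a z `^ p)%:E + (b z `^ p)%:E)))%E).
  apply: ge0_le_integralT => z; first by rewrite lee_fin powR_ge0.
  rewrite -EFinD -EFinM lee_fin (le_trans _ (powRD_le _ _ p0))//.
  by apply: ge0_ler_powR; rewrite ?nnegrE ?addr_ge0.
rewrite ge0_integralZl_EFin ?powR_ge0//; last 2 first.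
- by move=> z _; rewrite -EFinD lee_fin addr_ge0 ?powR_ge0.
- by apply: emeasurable_funD; exact: mp.
rewrite ge0_integralD//; last 4 first.
- by move=> z _; rewrite lee_fin powR_ge0.
- exact: mp.
- by move=> z _; rewrite lee_fin powR_ge0.
- exact: mp.
by rewrite lte_mul_pinfty ?lee_fin ?powR_ge0// lte_add_pinfty.
Qed.

(** * Measurability of the distance and finiteness of [Wp] on a separable metric space *)

Section metric_transport.
Context (R : realType) d (T : measurableType d) (dist : T -> T -> R) (p : R).
Hypothesis dmet : is_metric dist.
Hypothesis dsep : metric_separable dist.
Hypothesis dbor : borel_for dist.
Hypothesis p1 : 1 <= p.

Let d0 x y : 0 <= dist x y. Proof. by case: dmet. Qed.
Let dxx x : dist x x = 0. Proof. by case: dmet => _ /(_ x x)[_ ->]. Qed.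
Let dsym x y : dist x y = dist y x. Proof. by case: dmet. Qed.
Let dtri x y z : dist x z <= dist x y + dist y z. Proof. by case: dmet. Qed.
Let p0 : 0 < p. Proof. exact: lt_le_trans p1. Qed.
Let pN0 : p != 0. Proof. by rewrite gt_eqF. Qed.

Lemma metric_open_measurable A : metric_open dist A -> measurable A.
Proof. by move=> oA; rewrite dbor; exact: sub_sigma_algebra. Qed.

Lemma measurable_dist1 s : measurable_fun setT (dist s).
Proof.
apply: (measurability (@RGenInftyO.G R) (@RGenInftyO.measurableE R)).
move=> _ [_ [r ->] <-]; rewrite setTI; apply: metric_open_measurable => x /=.
rewrite in_itv/= => sxr; exists (r - dist s x); first by rewrite subr_gt0.
move=> y; rewrite /dball/= in_itv/= ltrBrDl; apply: le_lt_trans.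
exact: dtri.
Qed.

(** Measurability is for the product sigma-algebra. Separability writes [dist x y < r] as a
    countable union, over [s] in a dense set, of the conditions [dist s x + dist s y < r]. *)
Lemma measurable_dist : measurable_fun setT (fun z : T * T => dist z.1 z.2).
Proof.
apply: (measurability (@RGenInftyO.G R) (@RGenInftyO.measurableE R)).
move=> _ [_ [r ->] <-]; rewrite setTI.
have [D [cD Ddense]] := dsep.
have -> : (fun z : T * T => dist z.1 z.2) @^-1` `]-oo, r[ =
    \bigcup_(s in D) [set z | dist s z.1 + dist s z.2 < r].
  apply/seteqP; split=> [[x y]|[x y] [s Ds]] /=; rewrite in_itv/=; last first.
    by apply: le_lt_trans; rewrite (dsym s); exact: dtri.
  (* The detour through [s] lengthens the path by at most [2 * dist x s], hence half of the gap. *)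
  move=> xyr; have e0 : 0 < (r - dist x y) / 2 by rewrite divr_gt0// subr_gt0.
  have [s Ds xs] := Ddense x _ e0; exists s => //=.
  apply: (@le_lt_trans _ _ (dist x s + (dist x s + dist x y))).
    by rewrite (dsym s x) lerD2l (dsym x s); exact: dtri.
  by rewrite addrA -ltrBrDr [ltRHS]splitr ltrD.
apply: countable_bigcup_measurable => // s _.
have mf : measurable_fun setT (fun z : T * T => dist s z.1 + dist s z.2).
  by apply: measurable_funD; apply: measurableT_comp => //;
    exact: measurable_dist1.
rewrite [X in measurable X](_ : _ =
  setT `&` (fun z : T * T => dist s z.1 + dist s z.2) @^-1` `]-oo, r[).
  exact: mf.
by rewrite setTI; apply/seteqP; split=> z /=; rewrite in_itv.
Qed.

Lemma measurable_dist_powR d' (Z : measurableType d') (f g : Z -> T) :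
  measurable_fun setT f -> measurable_fun setT g ->
  measurable_fun setT (fun z => (dist (f z) (g z) `^ p)%:E).
Proof.
move=> mf mg; apply/measurable_EFinP.
apply: (measurableT_comp (measurable_powR p)).
apply: (measurableT_comp measurable_dist (measurable_fun_pair mf mg)).
Qed.

Lemma Pp_basepoint (mu : probability T R) (o : T) : Pp dist p mu ->
  (\int[mu]_x (dist o x `^ p)%:E < +oo)%E.
Proof.
move=> [q multy].
apply: (integral_powRD_lty (ltW p0) (measurable_cst (dist o q))
  (measurable_dist1 q) (fun=> d0 _ _) (fun=> d0 _ _) (fun=> d0 _ _)
  (fun=> dtri _ _ _) _ multy).
rewrite [integral _ _ _](integral_cst _ measurableT (dist o q `^ p)%:E).
by rewrite /= probability_setT mule1 ltry.
Qed.

(** The product measure is a coupling, and its cost is finite by the triangle inequality through a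
    base point. *)
Lemma Wp_fin_num (mu nu : probability T R) : Pp dist p mu -> Pp dist p nu ->
  Wp dist p mu nu \is a fin_num.
Proof.
move=> muP nuP; rewrite ge0_fin_numE ?Wp_ge0//.
pose P : probability (T * T)%type R := (mu \x nu)%E.
have mu1 A : measurable A -> P (fst @^-1` A) = mu A.
  move=> mA; rewrite -setXT /P/=.
  by rewrite product_measure1E//= probability_setT mule1.
have nu2 A : measurable A -> P (snd @^-1` A) = nu A.
  move=> mA; rewrite -setTX /P/=.
  by rewrite product_measure1E//= probability_setT mul1e.
have o : T := point.
have mo := measurable_dist1 o.
apply: le_lt_trans.
  apply: (@Wp_le_map _ _ _ _ _ _ _ P fst snd) => //.
  - by move=> A /mu1.
  - by move=> A /nu2.
  - exact: ltW.
apply: poweR_lty.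
have dfst : measurable_fun setT (dist o \o fst : T * T -> R).
  exact: measurableT_comp.
have dsnd : measurable_fun setT (dist o \o snd : T * T -> R).
  exact: measurableT_comp.
apply: (integral_powRD_lty (ltW p0) dfst dsnd (fun=> d0 _ _) (fun=> d0 _ _)
  (fun=> d0 _ _)).
- by move=> z /=; rewrite (dsym o z.1); exact: dtri.
- rewrite (@coupling_integral _ _ _ _ _ _ mu fst
    (fun x => (dist o x `^ p)%:E))//; first exact: Pp_basepoint.
  + exact: measurable_dist_powR.
  + by move=> x; rewrite lee_fin powR_ge0.
- rewrite (@coupling_integral _ _ _ _ _ _ nu snd
    (fun x => (dist o x `^ p)%:E))//; first exact: Pp_basepoint.
  + exact: measurable_dist_powR.
  + by move=> x; rewrite lee_fin powR_ge0.
Qed.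

Lemma Pp_dirac (x : T) : Pp dist p (\d_x : probability T R).
Proof.
exists x; rewrite integral_dirac//; last first.
  exact: measurable_dist_powR.
by rewrite diracT mul1e ltry.
Qed.

(** * Measures at Wasserstein distance zero, by inner approximation of open sets *)

Definition erosion (U : set T) (r : R) := [set x | dball dist x r `<=` U].

(** The complement is open: a point outside [U] at distance less than [r] from [x] is also that
    close to every point near [x]. *)
Lemma measurable_erosion U r : measurable (erosion U r).
Proof.
rewrite -[erosion U r]setCK; apply/measurableC/metric_open_measurable => x /=.
rewrite /erosion/= => /existsNP[y /not_implyP[xy Uy]].
exists (r - dist x y); first by rewrite subr_gt0.
move=> x' xx' /(_ y) h; apply: Uy; apply: h; rewrite /dball/=.
apply: le_lt_trans (dtri _ x _) _.
by rewrite -ltrBrDr dsym.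
Qed.

Lemma erosion_bigcup U : metric_open dist U ->
  \bigcup_n erosion U n.+1%:R^-1 = U.
Proof.
move=> oU; apply/seteqP; split=> [x [n _]|x Ux].
  by move=> h; apply: h; rewrite /dball/= dxx invr_gt0.
have [e e0 eU] := oU _ Ux.
(* The truncation [n] satisfies [e^-1 < n.+1], so the radius [n.+1^-1] is below [e]. *)
exists (Num.truncn e^-1) => // y; rewrite /dball/= => xy; apply: eU.
rewrite /dball/=; apply: lt_trans xy _.
by rewrite invf_plt ?posrE//; exact: truncnS_gt.
Qed.

(* A unit of mass that [pi] moves out of [U] from its [r]-erosion travels at
   least [r], so cheap couplings move almost none (Markov's inequality). *)
Lemma measure_erosion_le (mu nu : probability T R) U r : 0 < r ->
  metric_open dist U -> Wp dist p mu nu = 0%E ->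
  (mu (erosion U r) <= nu U)%E.
Proof.
move=> r0 oU W0; apply/lee_addgt0Pr => e e0.
have mU := metric_open_measurable oU; have mE := measurable_erosion U r.
have rp0 : 0 < r `^ p by rewrite powR_gt0.
(* The threshold is set so that Markov's inequality, which divides the cost by [r ^ p], leaves mass
   at most [e]. *)
have /ereal_inf_ltP[_ [pi cpi <-]] :
    (Wp dist p mu nu < ((e * r `^ p) `^ p^-1)%:E)%E.
  by rewrite W0 lte_fin powR_gt0// mulr_gt0.
set C := (\int[pi]_z _)%E => Clt.
have C0 : (0 <= C)%E by apply: integral_ge0 => z _; rewrite lee_fin powR_ge0.
have {}Clt : (C <= (e * r `^ p)%:E)%E.
  rewrite leNgt; apply/negP => /ltW ltC; move: Clt; apply/negP; rewrite -leNgt.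
  rewrite -poweR_EFin; apply: gt0_ler_poweR; rewrite ?invr_ge0 ?(ltW p0)//.
  - by rewrite in_itv/= leey andbT lee_fin mulr_ge0// ltW.
  - by rewrite in_itv/= leey andbT.
pose B := [set z : T * T | r <= dist z.1 z.2].
have mB : measurable B.
  rewrite [B](_ : _ = setT `&` (fun z : T * T => dist z.1 z.2) @^-1` `[r, +oo[).
    exact: measurable_dist.
  by rewrite setTI; apply/seteqP; split=> z /=; rewrite in_itv/= andbT.
have mf A : measurable A -> measurable (fst @^-1` A : set (T * T)).
  by move=> mA; rewrite -[X in measurable X]setTI; exact: measurable_fst.
have ms A : measurable A -> measurable (snd @^-1` A : set (T * T)).
  by move=> mA; rewrite -[X in measurable X]setTI; exact: measurable_snd.
have <- : pi (fst @^-1` erosion U r) = mu (erosion U r) by case: (cpi _ mE).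
have <- : pi (snd @^-1` U) = nu U by case: (cpi _ mU).
apply: (@le_trans _ _ (pi (snd @^-1` U `|` B))).
  apply: le_measure; rewrite ?inE; [exact: mf|exact: measurableU (ms _ mU) mB|].
  move=> [x y] /= Ex; have [rxy|xyr] := leP r (dist x y); first by right.
  by left; exact: Ex.
apply: le_trans (measureU2 _ (ms _ mU) mB) _.
rewrite leeD2l//.
have : ((r `^ p)%:E * pi B <= C)%E.
  apply: ge0_markovT => //; first exact: ltW.
    by move=> z; rewrite lee_fin powR_ge0.
  move=> z rz; rewrite lee_fin; apply: ge0_ler_powR; rewrite ?nnegrE//.
  - exact: ltW.
  - exact: ltW.
by move=> /le_trans/(_ Clt); rewrite muleC EFinM lee_pmul2r// lte_fin.
Qed.

(** Erosions increase to an open set, so [mu U <= nu U] for open [U]; symmetry gives equality. Open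
    sets are stable under intersection and generate the sigma-algebra, so the measures agree on
    it. *)
Lemma Wp_eq0 (mu nu : probability T R) : Wp dist p mu nu = 0%E ->
  forall A, measurable A -> mu A = nu A.
Proof.
have le_open (mu' nu' : probability T R) U : Wp dist p mu' nu' = 0%E ->
    metric_open dist U -> (mu' U <= nu' U)%E.
  move=> W0 oU; rewrite -[in leLHS](erosion_bigcup oU).
  set E := fun n : nat => erosion U n.+1%:R^-1.
  have mE n : measurable (E n) by exact: measurable_erosion.
  have cvgE : mu' \o E @ \oo --> mu' (\bigcup_n E n).
    apply: nondecreasing_cvg_mu => //; first exact: bigcupT_measurable.
    move=> n k nk; apply/subsetPset => x xn y yk; apply: xn.
    rewrite /dball/=; apply: lt_le_trans yk _.
    by rewrite lef_pV2 ?posrE// ler_nat ltnS.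
  rewrite -(cvg_lim _ cvgE)//.
  apply: lime_le; first by apply: cvgP; exact: cvgE.
  by apply: nearW => n; apply: measure_erosion_le => //; rewrite invr_gt0.
move=> W0; have W0' : Wp dist p nu mu = 0%E.
  by apply/eqP; rewrite eq_le Wp_ge0 -[in leRHS]W0 Wp_sym// ltW.
apply: (measure_unique (metric_open dist) (fun=> setT)) => //.
- move=> A B oA oB x [Ax Bx]; have [e e0 eA] := oA _ Ax.
  have [r r0 rB] := oB _ Bx; exists (Num.min e r); first by rewrite lt_min e0.
  move=> y; rewrite /dball/= lt_min => /andP[ye yr].
  by split; [exact: eA|exact: rB].
- by move=> _ x _; exists 1.
- by rewrite bigcup_const//; exists 0%N.
- by move=> A oA; apply/eqP; rewrite eq_le !le_open.
- by move=> _; rewrite /= probability_setT ltry.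
Qed.

(** Each coupling is pushed forward by [(phi, phi)]; the factor [k ^ p] leaves the integral and
    becomes [k] under the root. *)
Lemma Wp_pushforward_lipschitz d' (Y : measurableType d') (c : Y -> Y -> R)
    (phi : T -> Y) (k : R) (mu nu : probability T R) :
  measurable_fun setT phi -> 0 <= k -> (forall x y, 0 <= c x y) ->
  (forall x y, c (phi x) (phi y) <= k * dist x y) ->
  Wp dist p mu nu \is a fin_num ->
  (Wp c p (pushforward mu phi) (pushforward nu phi) <=
   k%:E * Wp dist p mu nu)%E.
Proof.
move=> mphi k0 c0 cphi Wfin.
have lepi pi : couplings mu nu pi ->
    (Wp c p (pushforward mu phi) (pushforward nu phi) <=
     k%:E * (\int[pi]_z (dist z.1 z.2 `^ p)%:E) `^ p^-1)%E.
  move=> cpi.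
  have mphiV A : measurable A -> measurable (phi @^-1` A).
    by move=> mA; rewrite -[X in measurable X]setTI; exact: mphi.
  apply: le_trans.
    apply: (@Wp_le_map _ _ _ _ _ _ _ pi (phi \o fst) (phi \o snd)).
    - exact: measurableT_comp.
    - exact: measurableT_comp.
    - by move=> A /mphiV mA; rewrite /pushforward -(cpi _ mA).1.
    - by move=> A /mphiV mA; rewrite /pushforward -(cpi _ mA).2.
    - exact: ltW.
  have md := @measurable_dist_powR _ _ _ _ (@measurable_fst _ _ T T)
    (@measurable_snd _ _ T T).
  have i0 : (0 <= \int[pi]_z (dist z.1 z.2 `^ p)%:E)%E.
    by apply: integral_ge0 => z _; rewrite lee_fin powR_ge0.
  rewrite -(poweR_powRV k0 pN0) -poweRM ?lee_fin ?powR_ge0//.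
  rewrite -ge0_integralZl_EFin ?powR_ge0//; last first.
    by move=> z _; rewrite lee_fin powR_ge0.
  apply: gt0_ler_poweR; rewrite ?invr_ge0 ?(ltW p0)// ?in_itv/= ?leey ?andbT.
  - by apply: integral_ge0 => z _; rewrite lee_fin powR_ge0.
  - by apply: integral_ge0 => z _; rewrite -EFinM lee_fin mulr_ge0 ?powR_ge0.
  - apply: ge0_le_integralT => z; first by rewrite lee_fin powR_ge0.
    rewrite -EFinM lee_fin -powRM//.
    by apply: ge0_ler_powR; rewrite ?nnegrE ?(ltW p0) ?mulr_ge0.
(* Passing to the infimum divides by [k]. For [k = 0] a single coupling is enough, and one exists
   because the distance is finite. *)
move: k0; rewrite le_eqVlt => /predU1P[k0|k0].
  have /ereal_inf_lt[_ [pi cpi _] _] : (Wp dist p mu nu < +oo)%E.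
    by rewrite -ge0_fin_numE ?Wp_ge0.
  by have := lepi _ cpi; rewrite -k0 !mul0e.
rewrite muleC -lee_pdivrMr//; apply/ereal_infP => _ [pi cpi <-].
by rewrite lee_pdivrMr// muleC; exact: lepi.
Qed.

(** * Laws as points of the Wasserstein space *)

Section wasserstein_space.
Variable w : {mu : probability T R | Pp dist p mu}.

Lemma dWSE (a b : WpSpace dist p w) :
  ((dWS dist p w a b)%:E = Wp dist p (proj1_sig a) (proj1_sig b))%E.
Proof.
by case: a b => [mu muP] [nu nuP]; rewrite /dWS /dW fineK// Wp_fin_num.
Qed.

Lemma dWS_ge0 (a b : WpSpace dist p w) : 0 <= dWS dist p w a b.
Proof. by rewrite -lee_fin dWSE Wp_ge0. Qed.

(* Two elements of [probability T R] may differ on nonmeasurable sets only, so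
   singletons of [WpSpace] need not be measurable; these classes replace them. *)
Definition law_class (a : WpSpace dist p w) : set (WpSpace dist p w) :=
  [set b | forall A, measurable A ->
    (proj1_sig b : probability T R) A = (proj1_sig a : probability T R) A].

(** The complement is open: a [b] outside the class lies at positive distance from [a], and all
    members of the class are at that same distance from [b]. *)
Lemma measurable_law_class a : measurable (law_class a).
Proof.
rewrite -[law_class a]setCK; apply: measurableC.
apply: sub_sigma_algebra => b nab.
exists (dWS dist p w b a).
  rewrite lt_neqAle dWS_ge0 andbT; apply/eqP => /esym ba0; apply: nab.
  by apply: Wp_eq0; rewrite -dWSE ba0.
move=> b'; rewrite /dball/= => bb' ab'; move: bb'; apply/negP; rewrite -leNgt.
by rewrite -lee_fin !dWSE; rewrite (eq_Wp dist p (fun _ _ => erefl) ab').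
Qed.

(** Every coupling is concentrated on the product of the two classes, where the distance is
    constantly that of [a] and [b]. This serves for push-forwards of Diracs. *)
Lemma Wp_law_class_ge a b (mu nu : set (WpSpace dist p w) -> \bar R) :
  mu (law_class a) = 1%E -> nu (law_class b) = 1%E ->
  (Wp dist p (proj1_sig a) (proj1_sig b) <= Wp (dWS dist p w) p mu nu)%E.
Proof.
move=> mua nub; apply/ereal_infP => _ [pi cpi <-].
have ma := measurable_law_class a; have mb := measurable_law_class b.
have mAB : measurable (fst @^-1` law_class a `&` snd @^-1` law_class b).
  apply: measurableI; rewrite -[X in measurable X]setTI.
    exact: measurable_fst.
  exact: measurable_snd.
have pi1 : pi (fst @^-1` law_class a `&` snd @^-1` law_class b) = 1%E.
  apply: probability_setI1.
  - by rewrite -[X in measurable X]setTI; exact: measurable_fst.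
  - by rewrite -[X in measurable X]setTI; exact: measurable_snd.
  - by rewrite -mua; case: (cpi _ ma).
  - by rewrite -nub; case: (cpi _ mb).
rewrite -dWSE -(poweR_powRV (dWS_ge0 a b) pN0).
apply: gt0_ler_poweR; rewrite ?invr_ge0 ?(ltW p0)// ?in_itv/= ?leey ?andbT.
- by rewrite lee_fin powR_ge0.
- by apply: integral_ge0 => z _; rewrite lee_fin powR_ge0.
rewrite -[leLHS]mule1 -pi1; apply: ge0_markovT => //.
- exact: powR_ge0.
- by move=> z; rewrite lee_fin powR_ge0.
move=> z [za zb]; rewrite lee_fin.
suff -> : dWS dist p w z.1 z.2 = dWS dist p w a b by [].
by apply: EFin_inj; rewrite !dWSE; exact: eq_Wp.
Qed.

End wasserstein_space.

End metric_transport.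

(** * Equality of the curvature infima over points and over measures *)

Theorem theorem1p2 (R : realType) (dX : measure_display) (X : measurableType dX)
  (dist : X -> X -> R) (p : R)
  (m : X -> probability X R) (hm : forall x, Pp dist p (m x))
  (w := exist (Pp dist p) (m point) (hm point))
  (mP := fun x : X => exist (Pp dist p) (m x) (hm x) : WpSpace dist p w)
  (mtilde := fun mu : WpSpace dist p w => pushforward (proj1_sig mu) mP) :
  polish_metric dist -> borel_for dist -> 1 <= p ->
  measurable_fun setT mP ->
  (forall mu, exists P : probability (WpSpace dist p w) R,
      forall A, measurable A -> P A = mtilde mu A) /\
  inf_kappa dist (fun x y => Wp dist p (m x) (m y)) =
  inf_kappa (dWS dist p w)
    (fun mu nu => Wp (dWS dist p w) p (mtilde mu) (mtilde nu)).
Proof.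
move=> [dmet _ dsep] dbor p1 mmP.
have p0 : 0 < p by exact: lt_le_trans p1.
have d0 x y : 0 <= dist x y by case: dmet.
have d_eq0 x y : dist x y = 0 <-> x = y by case: dmet.
have dWE (a b : WpSpace dist p w) :
    ((dWS dist p w a b)%:E = Wp dist p (proj1_sig a) (proj1_sig b))%E.
  exact: dWSE.
have dW_ge0 (a b : WpSpace dist p w) : 0 <= dWS dist p w a b.
  exact: dWS_ge0.
have PpD z : Pp dist p (\d_z : probability X R) by exact: Pp_dirac.
split.
  move=> mu; pose mP_mixin := isMeasurableFun.Build _ _ _ _ _ mmP.
  pose h : {mfun X >-> WpSpace dist p w} := HB.pack mP mP_mixin.
  by exists (distribution (proj1_sig mu : probability X R) h).
apply/eqP; rewrite eq_le; apply/andP; split; last first.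
  apply/ereal_infP => _ [x [y [xy ->]]].
  pose dx : WpSpace dist p w :=
    exist (Pp dist p) (\d_x : probability X R) (PpD x).
  pose dy : WpSpace dist p w :=
    exist (Pp dist p) (\d_y : probability X R) (PpD y).
  have dxy : dx <> dy.
    move=> /(congr1 (fun a : WpSpace dist p w =>
      (proj1_sig a : probability X R) [set x])) /=.
    rewrite !diracE mem_set// memNset; last by move=> yx; apply: xy.
    by move=> [/eqP]; rewrite oner_eq0.
  apply: ge_ereal_inf; exists (kappa (dWS dist p w) (fun mu nu =>
    Wp (dWS dist p w) p (mtilde mu) (mtilde nu)) dx dy).
    by exists dx, dy.
  have dxy_gt0 : 0 < dWS dist p w dx dy.
    rewrite lt_neqAle dW_ge0 andbT; apply/eqP => /esym W0.
    (* This preimage is the singleton of [x], in a form that is visibly measurable; it separates the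
       two Diracs. *)
    have mx : measurable (dist x @^-1` [set 0]).
      rewrite -[X in measurable X]setTI.
      exact: (measurable_dist1 dmet dbor).
    have := Wp_eq0 dmet dsep dbor p1 (etrans (esym (dWE dx dy))
      (congr1 EFin W0)) mx.
    rewrite /= !diracE mem_set; last exact/d_eq0.
    rewrite memNset; last by move=> /= /d_eq0.
    by move=> [/eqP]; rewrite oner_eq0.
  (* Replacing points by Diracs does not decrease the numerator and does not increase the
     denominator, so the curvature does not increase. *)
  apply: leeB => //; apply: lee_pmul.
  - exact: Wp_ge0.
  - by rewrite lee_fin invr_ge0.
  - apply: (@Wp_law_class_ge _ _ _ _ _ dmet dsep dbor p1 w (mP x) (mP y)) => //.
    + by rewrite /mtilde /pushforward /= diracE mem_set.
    + by rewrite /mtilde /pushforward /= diracE mem_set.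
  - have dxyle : dWS dist p w dx dy <= dist x y.
      by rewrite -lee_fin dWE; exact: Wp_dirac_le.
    by rewrite lee_fin lef_pV2 ?posrE// (lt_le_trans dxy_gt0).
apply/ereal_infP => _ [mu [nu [munu ->]]].
(* A space with one point carries only one law. Distinct points make the infimum over pairs
   nonempty, so [K] is at most 1: this excludes [+oo] and makes [1 - k] nonnegative. *)
have [x [y xy]] : exists x y : X, x <> y.
  apply: contrapT => noxy; apply: munu.
  apply: (eq_sig_hprop (fun _ => @Prop_irrelevance _)).
  apply: probability_singleton_eq => x.
  by apply: contrapT => xpt; apply: noxy; exists x, point.
set K := inf_kappa dist _.
have Kle x1 y1 : x1 <> y1 ->
    (K <= kappa dist (fun x y => Wp dist p (m x) (m y)) x1 y1)%E.
  by move=> xy1; apply: ereal_inf_lbound; exists x1, y1.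
have kappa_le1 x1 y1 :
    (kappa dist (fun x y => Wp dist p (m x) (m y)) x1 y1 <= 1)%E.
  rewrite /kappa -[leRHS]sube0; apply: leeB => //.
  by rewrite mule_ge0 ?Wp_ge0// lee_fin invr_ge0.
have K1 : (K <= 1)%E := le_trans (Kle _ _ xy) (kappa_le1 x y).
case: K Kle K1 => [k|_|_ _]; [|by []|exact: leNye].
move=> kle k1.
have mP_lip x1 y1 : dWS dist p w (mP x1) (mP y1) <= (1 - k) * dist x1 y1.
  have [->|x1y1] := pselect (x1 = y1).
    rewrite (_ : dWS _ _ _ _ _ = 0) ?mulr_ge0 ?subr_ge0//.
    by apply: EFin_inj; rewrite dWE Wp_id// => z; exact/d_eq0.
  have dxy : 0 < dist x1 y1.
    rewrite lt_neqAle d0 andbT; apply/eqP => /esym/d_eq0.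
    exact: x1y1.
  have := kle _ _ x1y1; rewrite /kappa -(dWE (mP x1) (mP y1)).
  by rewrite -EFinM -EFinB lee_fin lerBrDl -lerBrDr ler_pdivrMr.
have W_le : (Wp (dWS dist p w) p (mtilde mu) (mtilde nu) <=
    ((1 - k) * dWS dist p w mu nu)%:E)%E.
  rewrite EFinM dWE; apply: (Wp_pushforward_lipschitz dmet dsep dbor p1) => //.
  - by rewrite subr_ge0.
  - by rewrite -dWE.
have Wfin : Wp (dWS dist p w) p (mtilde mu) (mtilde nu) \is a fin_num.
  by rewrite ge0_fin_numE ?Wp_ge0// (le_lt_trans W_le)// ltry.
rewrite /kappa; move: W_le; rewrite -(fineK Wfin) -EFinM -EFinB !lee_fin => W_le.
(* At distance zero the curvature reads as 1, and the claim is [k <= 1]. *)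
have [dW0|dWN0] := eqVneq (dWS dist p w mu nu) 0.
  by rewrite dW0 invr0 mulr0 subr0.
rewrite lerBrDl -lerBrDr ler_pdivrMr// lt_neqAle eq_sym dWN0.
exact: dW_ge0.
Qed.
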